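(* For positive integers $k\le n$, the Hilbert series of $S_{n,k}$ is $$\mathrm{Hilb}(S_{n,k};q)=\mathrm{rev}_q\big([k]!_q\cdot\mathrm{Stir}_q(n,k)\big).$$
   Context: $S_{n,k}=\mathbb F[x_1,\dots,x_n]/J_{n,k}$ for an arbitrary field $\mathbb F$, where $J_{n,k}$ is the homogeneous ideal generated by $h_k(x_1),h_k(x_1,x_2),\dots,h_k(x_1,\dots,x_n)$ (complete homogeneous symmetric polynomials) and $e_n,e_{n-1},\dots,e_{n-k+1}$ (elementary symmetric polynomials in $x_1,\dots,x_n$). $\mathrm{Hilb}(V;q)=\sum_d\dim(V_d)q^d$ for a graded vector space. $[k]!_q=\prod_{j=1}^k(1+q+\cdots+q^{j-1})$; $\mathrm{Stir}_q(0,k)=\delta_{0,k}$ and $\mathrm{Stir}_q(n,k)=\mathrm{Stir}_q(n-1,k-1)+[k]_q\mathrm{Stir}_q(n-1,k)$; $\mathrm{rev}_q(f)=q^{\deg f}f(q^{-1})$. *)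

(* Defs.v *)
From HB Require Import structures.
From mathcomp Require Import all_boot all_order all_algebra.
Set Implicit Arguments. Unset Strict Implicit. Unset Printing Implicit Defensive.
Import Order.TTheory GRing.Theory Num.Theory.
Local Open Scope ring_scope.

(* An exponent vector is a : 'I_n -> nat (variable x_{i+1} has exponent a i).      *)
(* A polynomial is given by its coefficient function (exponent vector -> F).      *)
Definition mpolyF (F : fieldType) (n : nat) := ('I_n -> nat) -> F.

Definition mulmon (F : fieldType) n (m : 'I_n -> nat) (p : mpolyF F n) : mpolyF F n :=
  fun a => if [forall i, (m i <= a i)%N] then p (fun i => (a i - m i)%N) else 0.

Definition hpoly (F : fieldType) n (k i : nat) : mpolyF F n :=
  fun a => if ((\sum_(j < n) a j)%N == k) && [forall j : 'I_n, (i <= j)%N ==> (a j == 0%N)]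
           then 1 else 0.

Definition epoly (F : fieldType) n (j : nat) : mpolyF F n :=
  fun a => if [forall l, (a l <= 1)%N] && ((\sum_(l < n) a l)%N == j) then 1 else 0.

(* generators of J_{n,k}, paired with their (homogeneous) degrees:
   h_k(x_1..x_i), 1 <= i <= n, and e_j, n-k+1 <= j <= n *)
Definition Jgens (F : fieldType) n k : seq (nat * mpolyF F n) :=
  [seq (k, @hpoly F n k i) | i <- iota 1 n] ++
  [seq (j, @epoly F n j) | j <- iota (n - k + 1) k].

Definition mon n d := {f : {ffun 'I_n -> 'I_d.+1} | (\sum_(i < n) (f i : nat))%N == d}.
Definition expo n d (m : mon n d) : 'I_n -> nat := fun i => val (val m i).

(* degree-d component of a polynomial, as a coordinate row vector
   in the monomial basis of R_d *)
Definition comp (F : fieldType) n d (p : mpolyF F n) : 'rV[F]_#|{: mon n d}| :=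
  \row_(j < #|{: mon n d}|) p (expo (enum_val j)).

(* degree-d component of the homogeneous ideal generated by Jgens:
   the span of x^m * g for generators g of degree e <= d and monomials m of degree d - e *)
Definition Jdeg (F : fieldType) n k d :=
  (\sum_(g <- @Jgens F n k | (g.1 <= d)%N)
     \sum_(m : mon n (d - g.1)) <<comp d (mulmon (expo m) g.2)>>)%MS.

(* dim_F (S_{n,k})_d = dim R_d - dim (J_{n,k})_d *)
Definition hilbS (F : fieldType) n k d : nat :=
  (#|{: mon n d}| - \rank (@Jdeg F n k d))%N.

Definition qint (k : nat) : {poly int} := \sum_(i < k) 'X^i.
Definition qfact (k : nat) : {poly int} := \prod_(j < k) qint j.+1.
Fixpoint stirq (n k : nat) : {poly int} :=
  match n, k with
  | 0, _ => (k == 0%N)%:R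
  | n'.+1, 0 => 0
  | n'.+1, k'.+1 => stirq n' k' + qint k * stirq n' k
  end.
(* rev_q f = q^{deg f} f(q^{-1}) : reverse the coefficient list *)
Definition revq (f : {poly int}) : {poly int} :=
  \poly_(i < size f) f`_(size f - 1 - i).

(* Main.v *)
Require Import Defs.
From HB Require Import structures.
From mathcomp Require Import all_boot all_order all_algebra.
From mathcomp Require Import fraction mpoly ring zify.
Set Implicit Arguments. Unset Strict Implicit. Unset Printing Implicit Defensive.
Import Order.TTheory GRing.Theory Num.Theory.
Local Open Scope ring_scope.

(** The reversed polynomials g_{n,k} satisfy
      g_{n,k} = [k]_q (g_{n-1,k} + q^(n-k) g_{n-1,k-1}).
    Upper bound.  Since x_1^k = 0 in S_{n,k}, filtering by powers of x_1 gives
    Hilb S_{n,k} <= [k]_q Hilb T with T = S_{n,k}/(x_1).  In the m = n-1 remaining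
    variables, T is the quotient by the h_k of the prefixes and by e_j, j > n-k; dividing
    further by e_{n-k} yields S_{m,k}, while e_{n-k} J_{m,k-1} vanishes in T because
      sum_l (-1)^l h_l(x_1..x_i) e_{m-l}(x_1..x_m) = e_m(x_{i+1}..x_m) = 0.
    Hence Hilb T <= Hilb S_{m,k} + q^(n-k) Hilb S_{m,k-1}.
    Lower bound.  Over an infinite extension of F, take distinct scalars L_0, L_1, ...
    and the k! Stir(n,k) points with distinct coordinates z_i in {L_0, ..., L_(k+i-1)}
    (i < n) that use L_0, ..., L_(k-1).  The same identity shows that every generator
    of J_{n,k} is the top form of a polynomial vanishing at these points, so the total
    dimension of S_{n,k} is at least their number, and all inequalities are equalities. *)

(** * Symmetric functions of a sequence *)

Section SymmetricFunctions.
Variable R : comNzRingType.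
Implicit Types (s u v w : seq R) (x : R).

Fixpoint esymf s (j : nat) : R :=
  match s, j with
  | _, 0 => 1
  | [::], _ => 0
  | x :: s', j'.+1 => esymf s' j + x * esymf s' j'
  end.

Fixpoint hsymf s (j : nat) : R :=
  if s is x :: s' then \sum_(i < j.+1) x ^+ i * hsymf s' (j - i) else (j == 0)%:R.
Arguments hsymf : simpl never.

Lemma esymf0 s : esymf s 0 = 1. Proof. by case: s. Qed.

Lemma hsymf0 s : hsymf s 0 = 1.
Proof. by elim: s => // x s IH; rewrite /hsymf big_ord1 -/hsymf expr0 mul1r IH. Qed.

Lemma hsymfS x s j : hsymf (x :: s) j.+1 = hsymf s j.+1 + x * hsymf (x :: s) j.
Proof.
rewrite {1}/hsymf big_ord_recl -/hsymf expr0 mul1r subn0 mulr_sumr; congr (_ + _).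
by apply: eq_bigr => i _; rewrite mulrA -exprS.
Qed.

(** The recursion [hsymfS] with the new variable on the right, which is where the prefixes
    [take i s] grow. *)
Lemma hsymf_rconsS s x j :
  hsymf (rcons s x) j.+1 = hsymf s j.+1 + x * hsymf (rcons s x) j.
Proof.
elim: s j => [|y s IH] j; first exact: hsymfS.
elim: j => [|j IHj]; rewrite rcons_cons; first by rewrite !hsymfS IH !hsymf0; ring.
rewrite rcons_cons in IHj.
rewrite [LHS]hsymfS IH [hsymf (y :: s) j.+2]hsymfS [in LHS]IHj.
by rewrite [in RHS](hsymfS y (rcons s x)); ring.
Qed.

Lemma hsymf_seq1 x j : hsymf [:: x] j = x ^+ j.
Proof.
elim: j => [|j IH]; first by rewrite hsymf0.
by rewrite hsymfS IH /hsymf /= add0r exprS.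
Qed.

Lemma esymf_small s j : (size s < j)%N -> esymf s j = 0.
Proof.
elim: s j => [|x s IH] [|j] //= lt_sj.
by rewrite !IH ?mulr0 ?addr0 //; lia.
Qed.

Lemma esymf_catC u v x j : esymf (u ++ x :: v) j = esymf (x :: u ++ v) j.
Proof.
elim: u j => [|y u IH] [|j] //=; rewrite !IH.
case: j => [|j] /=; rewrite ?esymf0; ring.
Qed.

Lemma perm_esymf s1 s2 : perm_eq s1 s2 -> esymf s1 =1 esymf s2.
Proof.
elim: s1 s2 => [|x s1 IH] s2 eq12 j.
  by move: eq12; rewrite perm_sym => /perm_nilP->.
have xs2 : x \in s2 by rewrite -(perm_mem eq12) mem_head.
case/splitPr: xs2 eq12 => u v eq12.
have {}eq12 : perm_eq s1 (u ++ v).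
  by move: eq12; rewrite perm_sym (perm_catCA u [:: x] v) /= perm_cons perm_sym.
by rewrite esymf_catC; case: j => //= j; rewrite !(IH _ eq12).
Qed.

(** The coefficient of $t^j$ in $H_u(-t)E_w(t)$; both bounds rest on its vanishing when $u$ is
    contained in $w$ and $j$ is large. *)
Definition hesum u w j := \sum_(l < j.+1) (-1) ^+ l * hsymf u l * esymf w (j - l).

Lemma hesum0 u w : hesum u w 0 = 1.
Proof. by rewrite /hesum big_ord1 hsymf0 esymf0 !mul1r. Qed.

Lemma hesum_consl x u w j :
  hesum (x :: u) w j.+1 = hesum u w j.+1 - x * hesum (x :: u) w j.
Proof.
rewrite /hesum [LHS]big_ord_recl [in RHS]big_ord_recl /= !hsymf0 -addrA; congr (_ + _).
rewrite mulr_sumr -sumrB; apply: eq_bigr => i _.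
rewrite /= /bump /= add1n subSS hsymfS exprS; ring.
Qed.

Lemma hesum_consr x u w j :
  hesum u (x :: w) j.+1 = hesum u w j.+1 + x * hesum u w j.
Proof.
rewrite /hesum [LHS]big_ord_recr [in RHS]big_ord_recr /= !subnn !esymf0.
rewrite addrAC; congr (_ + _); rewrite mulr_sumr -big_split /=.
apply: eq_bigr => i _; rewrite subSn; last by rewrite -ltnS.
by rewrite /= mulrDr; congr (_ + _); ring.
Qed.

(* The coefficient of t^j in H_u(-t) E_{u++v}(t) = E_v(t). *)
Lemma hesum_cat u v j : hesum u (u ++ v) j = esymf v j.
Proof.
elim: u v j => [|x u IH] v j.
  rewrite /hesum big_ord_recl /hsymf /= !mul1r subn0 big1 ?addr0 // => i _.
  by rewrite mulr0 mul0r.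
elim: j => [|j IHj]; first by rewrite hesum0 esymf0.
by rewrite hesum_consl IHj cat_cons hesum_consr !IH; ring.
Qed.

End SymmetricFunctions.

(** The coefficient of $q^d$ in $g_{n,k}$. If [n' < k'] the truncated shift is 0, which is harmless
    since [hdim n' k'] vanishes. *)
Fixpoint hdim (n k d : nat) : nat :=
  match n, k with
  | 0, 0 => (d == 0)
  | n'.+1, k'.+1 => \sum_(i < k | i <= d)
      (hdim n' k (d - i) + if n' - k' <= d - i then hdim n' k' (d - i - (n' - k')) else 0)
  | _, _ => 0
  end%N.

(** * Graded ideals and spanning sets *)

Section GradedIdeals.
Variables (F : fieldType) (A : comAlgType F).
Implicit Types (s : seq A) (x p q b : A) (B : seq A) (G : nat -> A -> Prop).

(** Forms of degree d in the elements of s, inside a fixed algebra: removing a variable shortens s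
    and leaves the ring unchanged. *)
Inductive homg s : nat -> A -> Prop :=
| homg_1 : homg s 0 1
| homg_0 d : homg s d 0
| homg_lin d (c : F) p q : homg s d p -> homg s d q -> homg s d (c *: p + q)
| homg_mulX d x p : x \in s -> homg s d p -> homg s d.+1 (x * p).

(* Degree-d part of the ideal generated in F[s] by the pairs (degree, element) in G. *)
Inductive idl s G : nat -> A -> Prop :=
| idl_0 d : idl s G d 0
| idl_gen d e c g p :
    G e g -> homg s d c -> idl s G (d + e) p -> idl s G (d + e) (c * g + p).

Inductive lspan B : A -> Prop :=
| lspan_0 : lspan B 0
| lspan_add (c : F) b p : b \in B -> lspan B p -> lspan B (c *: b + p).

Lemma homgD s d p q : homg s d p -> homg s d q -> homg s d (p + q).
Proof. by move=> hp hq; rewrite -[p]scale1r; apply: homg_lin. Qed.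

Lemma homgZ s d (c : F) p : homg s d p -> homg s d (c *: p).
Proof. by move=> hp; rewrite -[_ *: _]addr0; apply: homg_lin => //; apply: homg_0. Qed.

Lemma homgM s d e p q : homg s d p -> homg s e q -> homg s (d + e) (p * q).
Proof.
move=> hp hq; elim: hp => {d p} [|d|d c p p' _ IH _ IH'|d x p xs _ IH].
- by rewrite mul1r.
- by rewrite mul0r; apply: homg_0.
- by rewrite mulrDl -scalerAl; apply: homg_lin.
- by rewrite -mulrA addSn; apply: homg_mulX.
Qed.

Lemma homgX s x : x \in s -> homg s 1 x.
Proof. by move=> xs; rewrite -[x]mulr1; apply: homg_mulX => //; apply: homg_1. Qed.

Lemma homgXn s x i : x \in s -> homg s i (x ^+ i).
Proof.
move=> xs; elim: i => [|i IH]; first by rewrite expr0; apply: homg_1.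
by rewrite exprS; apply: homg_mulX.
Qed.

Lemma homg_subset s s' d p : {subset s <= s'} -> homg s d p -> homg s' d p.
Proof.
move=> ss'; elim=> {d p} [|d|d c p q _ IHp _ IHq|d x p xs _ IH].
- exact: homg_1.
- exact: homg_0.
- exact: homg_lin.
- by apply: homg_mulX => //; apply: ss'.
Qed.

Lemma homg_esymf s j : homg s j (esymf s j).
Proof.
elim: s j => [|x s IH] [|j] //=; try exact: homg_1; try exact: homg_0.
have sub : {subset s <= x :: s} by move=> y ys; rewrite inE ys orbT.
apply: homgD; first exact: homg_subset sub _.
by apply: homg_mulX; [rewrite mem_head | apply: homg_subset sub _].
Qed.

Lemma homg_hsymf s j : homg s j (hsymf s j).
Proof.
elim: s j => [|x s IH] j.
  by case: j => [|j]; [apply: homg_1 | apply: homg_0].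
have sub : {subset s <= x :: s} by move=> y ys; rewrite inE ys orbT.
elim: j => [|j IHj]; first by rewrite hsymf0; apply: homg_1.
rewrite hsymfS; apply: homgD; first exact: homg_subset sub _.
by apply: homg_mulX; rewrite ?mem_head.
Qed.

Lemma idl1 s G d e c g : G e g -> homg s d c -> idl s G (d + e) (c * g).
Proof.
by move=> Gg hc; rewrite -[_ * _]addr0; apply: idl_gen => //; apply: idl_0.
Qed.

Lemma idl_base s G e g : G e g -> idl s G e g.
Proof. by move=> Gg; rewrite -[g]mul1r -[e]add0n; apply: idl1 => //; apply: homg_1. Qed.

Lemma idlD s G d p q : idl s G d p -> idl s G d q -> idl s G d (p + q).
Proof.
elim=> {d p} [d|d e c g p Gg hc _ IH] hq; first by rewrite add0r.
by rewrite -addrA; apply: idl_gen => //; apply: IH.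
Qed.

Lemma idlM s G d e c p : homg s d c -> idl s G e p -> idl s G (d + e) (c * p).
Proof.
move=> hc; elim=> {e p} [e|e e' c' g p Gg hc' _ IH].
  by rewrite mulr0; apply: idl_0.
by rewrite mulrDr mulrA addnA; apply: idl_gen => //; [apply: homgM | rewrite -addnA].
Qed.

Lemma idlZ s G d (c : F) p : idl s G d p -> idl s G d (c *: p).
Proof.
move=> hp; rewrite -[p]mul1r scalerAl -[d]add0n; apply: idlM => //.
by apply: homgZ; apply: homg_1.
Qed.

Lemma idl_sign s G d i p : idl s G d p -> idl s G d ((-1) ^+ i * p).
Proof. by move=> hp; rewrite -signr_odd mulr_sign -scaleN1r; case: odd => //; apply: idlZ. Qed.

Lemma idl_sum s G d (I : Type) (r : seq I) (P : pred I) (f : I -> A) :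
  (forall i, P i -> idl s G d (f i)) -> idl s G d (\sum_(i <- r | P i) f i).
Proof. by move=> hf; elim/big_ind: _ => //; [apply: idl_0 | apply: idlD]. Qed.

Lemma lspan_mem B b : b \in B -> lspan B b.
Proof.
move=> bB; rewrite -[b]scale1r -[_ *: _]addr0.
by apply: lspan_add => //; apply: lspan_0.
Qed.

Lemma lspanD B p q : lspan B p -> lspan B q -> lspan B (p + q).
Proof.
elim=> {p} [|c b p bB _ IH] hq; first by rewrite add0r.
by rewrite -addrA; apply: lspan_add => //; apply: IH.
Qed.

Lemma lspanZ B (c : F) p : lspan B p -> lspan B (c *: p).
Proof.
elim=> {p} [|c' b p bB _ IH]; first by rewrite scaler0; apply: lspan_0.
by rewrite scalerDr scalerA; apply: lspan_add.
Qed.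

Lemma lspan_mulr B B' a p :
  {in B, forall b, a * b \in B'} -> lspan B p -> lspan B' (a * p).
Proof.
move=> sub; elim=> {p} [|c b p bB _ IH]; first by rewrite mulr0; apply: lspan_0.
by rewrite mulrDr -scalerAr; apply: lspan_add => //; apply: sub.
Qed.

Definition covered s G d B p := exists2 b, lspan B b & idl s G d (p - b).

(** B spans degree d of the quotient of F[s] by the ideal of G, so its size bounds the dimension
    there. *)
Definition covers s G d B := forall p, homg s d p -> covered s G d B p.

Lemma covered_idl s G d B p : idl s G d p -> covered s G d B p.
Proof. by move=> hp; exists 0; [apply: lspan_0 | rewrite subr0]. Qed.

Lemma covered_lspan s G d B p : lspan B p -> covered s G d B p.
Proof. by move=> hp; exists p => //; rewrite subrr; apply: idl_0. Qed.

Lemma coveredD s G d B p q :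
  covered s G d B p -> covered s G d B q -> covered s G d B (p + q).
Proof.
move=> [b hb hp] [b' hb' hq]; exists (b + b'); first exact: lspanD.
by rewrite opprD addrACA; apply: idlD.
Qed.

Lemma coveredN s G d B p : covered s G d B p -> covered s G d B (- p).
Proof.
move=> [b hb hp]; exists (- b); first by rewrite -scaleN1r; apply: lspanZ.
by rewrite -opprD -scaleN1r; apply: idlZ.
Qed.

Lemma covers_idl1 s G d : idl s G 0 1 -> covers s G d [::].
Proof.
move=> h1 p hp; apply: covered_idl.
by rewrite -[p]mulr1 -[d]addn0; apply: idlM.
Qed.

(* The exact sequence  F[s]/G2 --e--> F[s]/GT --> F[s]/(GT, e) --> 0. *)
Lemma covers_adjoin s G1 G2 GT r e d B1 B2 :
  (forall j g, G1 j g -> GT j g \/ j = r /\ g = e) ->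
  (forall j g, G2 j g -> idl s GT (r + j) (e * g)) ->
  covers s G1 d B1 ->
  ((r <= d)%N -> covers s G2 (d - r) B2) ->
  covers s GT d (B1 ++ [seq e * b | b <- if (r <= d)%N then B2 else [::]]).
Proof.
move=> G1T G2T cov1 cov2; set B := B1 ++ _ => p /cov1[b hb hp].
rewrite -(subrK b p); apply: coveredD; last first.
  apply: covered_lspan; rewrite -[b]mul1r; apply: lspan_mulr hb => c cB1.
  by rewrite mul1r mem_cat cB1.
have gen d' j c g : G1 j g -> homg s d' c -> (d' + j)%N = d -> covered s GT d B (c * g).
  move=> /G1T[Gg hc <-|[-> ->] hc def_d]; first by apply: covered_idl; apply: idl1.
  have le_rd : (r <= d)%N by lia.
  have def_d' : (d - r)%N = d' by lia.
  (* The cofactor c of e is reduced modulo G2 to the span of B2; e times the error lies in the ideal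
     of GT. *)
  move: cov2; rewrite le_rd def_d' => /(_ isT c hc)[b' hb' hc'].
  rewrite mulrC -(subrK b' c) mulrDr; apply: coveredD; last first.
    apply: covered_lspan; apply: lspan_mulr hb' => b'' hb''.
    by rewrite mem_cat /B le_rd map_f ?orbT.
  apply: covered_idl; rewrite -def_d addnC.
  elim: {c hc def_d def_d'}hc' => [i|i j' c g' q Gg' hc _ IH].
    by rewrite mulr0; apply: idl_0.
  rewrite mulrDr; apply: idlD => //.
  by rewrite mulrCA addnCA; apply: idlM => //; apply: G2T.
suff main d' q : idl s G1 d' q -> d' = d -> covered s GT d B q by apply: main hp _.
elim=> {q d'}[d'|d' j c g q Gg hc _ IH] def_d.
  by apply: covered_idl; apply: idl_0.
by apply: coveredD; [apply: gen def_d | apply: IH].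
Qed.

Lemma homg_cons x s d p : homg (x :: s) d p ->
  exists2 q, homg s d q &
    if d is e.+1 then exists2 r, homg (x :: s) e r & p = q + x * r else p = q.
Proof.
elim=> {d p} [|d|d c p p' _ [q hq Hp] _ [q' hq' Hp']|d y p].
- by exists 1 => //; apply: homg_1.
- exists 0; first exact: homg_0.
  by case: d => // d; exists 0; [apply: homg_0 | rewrite mulr0 addr0].
- exists (c *: q + q'); first exact: homg_lin.
  case: d hq hq' Hp Hp' => [_ _ -> -> //|d _ _ [r hr ->] [r' hr' ->]].
  exists (c *: r + r'); first exact: homg_lin.
  by rewrite scalerDr mulrDr -scalerAr addrACA.
- rewrite inE => /predU1P[->|ys] hp [q hq Hp].
    by exists 0; [apply: homg_0 | exists p; rewrite ?add0r].
  exists (y * q); first exact: homg_mulX.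
  case: d hp hq Hp => [_ _ ->|d _ _ [r hr ->]].
    by exists 0; [apply: homg_0 | rewrite mulr0 addr0].
  exists (y * r); last by rewrite mulrDr mulrCA.
  by apply: homg_mulX => //; rewrite inE ys orbT.
Qed.

(* Filtration of F[x :: s]/GX by powers of x: multiplication by x^i maps
   F[s]/GT, the quotient by x, onto the i-th graded piece. *)
Lemma covers_cons x s GT GX k d (B : nat -> seq A) :
  (forall g, ~ GT 0 g) ->
  (forall j g, GT j.+1 g ->
     exists2 c, homg (x :: s) j c & idl (x :: s) GX j.+1 (g + x * c)) ->
  idl (x :: s) GX k (x ^+ k) ->
  (forall i, (i < k)%N -> (i <= d)%N -> covers s GT (d - i) (B i)) ->
  covers (x :: s) GX d
    (flatten [seq [seq x ^+ i * b | b <- B i] | i <- iota 0 k & (i <= d)%N]).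
Proof.
move=> GT0 GTX GXk covT; set Bx := flatten _.
have sub : {subset s <= x :: s} by move=> y ys; rewrite inE ys orbT.
have xx : x \in x :: s by rewrite mem_head.
(* Descending induction on the exponent i, with t = k - i; at t = 0 the element is a multiple of
   $x^k$, hence in the ideal. *)
suff claim t i e q : (i + t)%N = k -> (i + e)%N = d -> homg (x :: s) e q ->
    covered (x :: s) GX d Bx (x ^+ i * q).
  by move=> p hp; rewrite -[p]mul1r -(expr0 x); apply: (claim k 0 d).
elim: t i e q => [|t IH] i e q def_k def_d hq.
  apply: covered_idl; rewrite mulrC -def_d addnC; apply: idlM => //.
  by move: def_k; rewrite addn0 => ->.
have IHx e' q' : (i + e'.+1)%N = d -> homg (x :: s) e' q' ->
    covered (x :: s) GX d Bx (x ^+ i * (x * q')).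
  by move=> def_d' hq'; rewrite mulrA -exprSr; apply: (IH _ e'); rewrite // addSnnS.
have lt_ik : (i < k)%N by lia.
have le_id : (i <= d)%N by lia.
have def_e : (d - i)%N = e by lia.
have [q0 hq0 Hq] := homg_cons hq.
suff covq0 : covered (x :: s) GX d Bx (x ^+ i * q0).
  case: e {hq hq0 def_e} Hq def_d => [->//|e [r hr ->]] def_d.
  by rewrite mulrDr; apply: coveredD => //; apply: (IHx e).
have [b hb hq0b] : covered s GT e (B i) q0 by rewrite -def_e; apply: covT; rewrite ?def_e.
rewrite -(subrK b q0) mulrDr; apply: coveredD; last first.
  apply: covered_lspan; apply: lspan_mulr hb => b' hb'.
  apply/flatten_mapP; exists i; last exact: map_f.
  by rewrite mem_filter le_id mem_iota.
move: (q0 - b) hq0b def_d => {b hb q hq q0 hq0 Hq def_e} q.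
elim=> {e q} [e|e [|j] c g q Gg hc _ IHq] def_d.
- by rewrite mulr0; apply: covered_idl; apply: idl_0.
- by case: (GT0 g).
rewrite mulrDr; apply: coveredD; last exact: IHq.
(* The relation g lifts to g + x c' in the ideal of GX. The correction $x^{i+1} c c'$ has a higher
   power of x, so the induction hypothesis covers it. *)
have [c' hc' hg] := GTX _ _ Gg; have hcx := homg_subset sub hc.
have -> : x ^+ i * (c * g) = x ^+ i * c * (g + x * c') - x ^+ i * (x * (c * c')).
  by ring.
apply: coveredD.
  apply: covered_idl; rewrite -def_d addnA; apply: idlM => //.
  by apply: homgM => //; apply: homgXn.
apply: coveredN; apply: (IHx (e + j)%N); first by rewrite -addnS.
exact: homgM.
Qed.

(** * Spanning sets of the quotients by J *)

(* For k > size s the second clause contains e_0 = 1, so the quotient is zero. *)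
Definition gensJ s k (e : nat) (g : A) : Prop :=
  (e = k /\ exists2 i, (0 < i <= size s)%N & g = hsymf (take i s) k) \/
  ((size s < e + k)%N /\ g = esymf s e).

(* Generators of the image of J_{n,k} in the quotient by x_1, where s = x_2, ..., x_n. *)
Definition gensT s k (e : nat) (g : A) : Prop :=
  (e = k /\ exists2 i, (0 < i <= size s)%N & g = hsymf (take i s) k) \/
  (((size s).+1 < e + k)%N /\ g = esymf s e).

(** Double induction on $h_{j+1}(x_1..x_{i+1}) = h_{j+1}(x_1..x_i) + x_{i+1} h_j(x_1..x_{i+1})$;
    since k > 0, the empty prefix gives 0. *)
Lemma idl_hsymf_ge s G k i j : (0 < k <= j)%N -> (i <= size s)%N ->
  (forall i, (0 < i <= size s)%N -> idl s G k (hsymf (take i s) k)) ->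
  idl s G j (hsymf (take i s) j).
Proof.
move=> /andP[k_gt0 le_kj] le_is hk; elim: j le_kj i le_is => [|j IHj] le_kj i le_is.
  by lia.
elim: i le_is => [|i IHi] lt_is; first by rewrite take0; apply: idl_0.
move: le_kj; rewrite leq_eqVlt => /predU1P[<-|le_kj]; first exact: hk.
rewrite (take_nth 0) // hsymf_rconsS; apply: idlD; first by apply: IHi; apply: ltnW.
rewrite -(take_nth 0) // -add1n; apply: idlM; last exact: IHj.
by apply: homgX; apply: mem_nth.
Qed.

Lemma gensT_mul_esymf s k j g : (k <= size s)%N -> gensJ s k j g ->
  idl s (gensT s k.+1) (size s - k + j) (esymf s (size s - k) * g).
Proof.
move=> le_ks [[-> [i /andP[i_gt0 le_is] ->]]|[lt_s ->]]; last first.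
  apply: idlM; first exact: homg_esymf.
  by apply: idl_base; right; split=> //; rewrite addnS.
rewrite subnK //.
(* With m = [size s], the alternating sum of $h_l(x_1..x_i) e_{m-l}$ is $e_m$ of the fewer than m
   remaining variables, hence 0. Its term l = k is the product sought. *)
have := hesum_cat (take i s) (drop i s) (size s).
rewrite cat_take_drop esymf_small; last first.
  by rewrite size_drop ltn_subrL i_gt0 (leq_trans i_gt0).
have lt_ks : (k < (size s).+1)%N by [].
rewrite /hesum (bigD1 (Ordinal lt_ks)) //= => /eqP; rewrite addr_eq0 => /eqP eq_he.
rewrite mulrC -[hsymf _ _]mul1r -(sqrr_sign A k) expr2 -2!mulrA [X in _ * X]mulrA.
rewrite eq_he; apply: idl_sign; rewrite -scaleN1r; apply: idlZ.
apply: idl_sum => l ne_lk; rewrite -mulrA; apply: idl_sign.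
have le_l := ltn_ord l.
(* For l < k the factor $e_{m-l}$ is a generator of T; for l > k the factor $h_l$ is in the ideal by
   [idl_hsymf_ge]. *)
have [lt_lk|le_kl] := ltnP l k.
  rewrite -{1}(@subnKC l (size s)); last by lia.
  apply: idlM; last by apply: idl_base; right; split=> //; lia.
  by apply: homg_subset (homg_hsymf _ _) => y /mem_take.
rewrite mulrC -{1}(@subnK l (size s)); last by lia.
apply: idlM; first exact: homg_esymf.
apply: (@idl_hsymf_ge _ _ k.+1) => //.
  by move/eqP: ne_lk => ne_lk; apply: contra_notT ne_lk => ?; apply: val_inj => /=; lia.
by move=> i' hi'; apply: idl_base; left; split=> //; exists i'.
Qed.

(** Induction on the variables. The sigma type lets the spanning sets of the graded pieces be
    collected into a function of i. *)
Lemma covers_gensJ s k d :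
  {B | (size B <= hdim (size s) k d)%N & covers s (gensJ s k) d B}.
Proof.
elim: s k d => [|x s IH] k d.
  case: k => [|k]; last first.
    by exists [::] => //; apply: covers_idl1; apply: idl_base; right; split.
  exists (if d == 0%N then [:: 1] else [::]); first by rewrite /=; case: (d == 0%N).
  move=> p hp; apply: covered_lspan; elim: hp => [|d'|d' c q r _ Hq _ Hr|//].
  + by apply: lspan_mem; rewrite inE.
  + exact: lspan_0.
  + by apply: lspanD => //; apply: lspanZ.
have [lt_sk|] := ltnP (size (x :: s)) k.
  by exists [::] => //; apply: covers_idl1; apply: idl_base; right; split.
case: k => [_|k /= le_ks].
  (* For k = 0 with a variable present, the generator $h_0(x)$ is 1 and the quotient is zero. *)
  exists [::] => //; apply: covers_idl1; apply: idl_base; left; split=> //.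
  by exists 1%N; rewrite ?hsymf0.
pose r := (size s - k)%N.
have covT i : {B | (size B <= hdim (size s) k.+1 (d - i) +
      if r <= d - i then hdim (size s) k (d - i - r) else 0)%N &
    covers s (gensT s k.+1) (d - i) B}.
  have [B1 sB1 cov1] := IH k.+1 (d - i)%N.
  have [B2 sB2 cov2] := IH k (d - i - r)%N.
  exists (B1 ++ [seq esymf s r * b | b <- if (r <= d - i)%N then B2 else [::]]).
    by rewrite size_cat leq_add // size_map; case: ifP.
  apply: covers_adjoin cov1 (fun _ => cov2).
  - move=> j g [[-> Hg]|[lt_s ->]]; first by left; left.
    (* The two conditions on the degree differ by one, so only $e_r$ can be missing from [gensT]. *)
    have [lt_s1|ge_s1] := ltnP (size s).+1 (j + k.+1); first by left; right.
    by have -> : j = r; [rewrite /r; lia | right].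
  - by move=> j g; apply: gensT_mul_esymf.
pose B i := s2val (covT i).
exists (flatten [seq [seq x ^+ i * b | b <- B i] | i <- iota 0 k.+1 & (i <= d)%N]).
  rewrite size_flatten /shape -map_comp sumnE big_map big_filter.
  rewrite -[iota _ _]/(index_iota 0 k.+1) big_mkord; apply: leq_sum => i _.
  by rewrite /= size_map; apply: (s2valP (covT i)).
apply: (@covers_cons x s (gensT s k.+1)).
- by move=> g [[]|[]] //; lia.
- have sub : {subset s <= x :: s} by move=> y ys; rewrite inE ys orbT.
  (* Each generator of T is a generator of J at x = 0; the recursions for h and e supply the part
     divisible by x. *)
  move=> j g [[[->] [i hi ->]]|[lt_s ->]].
    exists (hsymf (x :: take i s) k); last first.
      by rewrite -hsymfS; apply: idl_base; left; split=> //; exists i.+1 => //; case/andP: hi.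
    apply: homg_subset (homg_hsymf _ _) => y.
    by rewrite !inE => /predU1P[->|/mem_take->]; rewrite ?eqxx ?orbT.
  exists (esymf s j); last by apply: idl_base; right; split.
  exact: homg_subset (homg_esymf _ _).
- apply: idl_base; left; split=> //; exists 1%N => //.
  by rewrite -hsymf_seq1 -(take0 s).
- by move=> i _ _; apply: (s2valP' (covT i)).
Qed.

End GradedIdeals.

(** * The reversed q-Stirling polynomial *)

(** g lists the coefficients of $q^D f(q^{-1})$. The explicit bound D, instead of the degree of f,
    makes the notion additive. *)
Definition isrev D (f : {poly int}) (g : nat -> nat) :=
  (forall e, (D < e)%N -> f`_e = 0) /\
  (forall d, (g d)%:Z = if (d <= D)%N then f`_(D - d) else 0).

Lemma isrev0 D g : g =1 (fun=> 0%N) -> isrev D 0 g.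
Proof. by move=> g0; split=> [e|d]; rewrite ?g0 coef0 ?if_same. Qed.

Lemma isrevD D f f' g g' :
  isrev D f g -> isrev D f' g' -> isrev D (f + f') (fun d => g d + g' d)%N.
Proof.
move=> [Hf Hg] [Hf' Hg']; split=> [e lt_De|d].
  by rewrite coefD Hf ?Hf' ?addr0.
by rewrite PoszD Hg Hg'; case: ifP => _; rewrite ?addr0 ?coefD.
Qed.

(** Reversing in degree D + a instead of D multiplies the result by $q^a$; this is the source of the
    factor $q^{n-k}$. *)
Lemma isrev_shift D a f g : isrev D f g ->
  isrev (D + a) f (fun d => if (a <= d)%N then g (d - a)%N else 0%N).
Proof.
move=> [Hf Hg]; split=> [e lt_De|d]; first by apply: Hf; lia.
case: ifP => le_ad; last by rewrite ifT ?Hf //; lia.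
rewrite Hg; have -> : (d - a <= D)%N = (d <= D + a)%N by lia.
by case: ifP => // _; congr (f`_ _); lia.
Qed.

Lemma isrev_qint D k f g : isrev D f g ->
  isrev (D + k) (qint k.+1 * f) (fun d => \sum_(i < k.+1 | i <= d) g (d - i))%N.
Proof.
move=> [Hf Hg]; have coefq e : (qint k.+1 * f)`_e =
    \sum_(i < k.+1) if (e < i)%N then 0 else f`_(e - i).
  by rewrite /qint mulr_suml coef_sum; apply: eq_bigr => i _; rewrite coefXnM.
split=> [e lt_De|d].
  rewrite coefq big1 // => i _; case: ifP => // /negbT le_ie.
  by apply: Hf; have := ltn_ord i; lia.
rewrite (big_morph Posz PoszD (erefl _)) big_mkcond /=.
case: leqP => [le_d|lt_d]; last first.
  rewrite big1 // => i _; case: ifP => // le_id.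
  by rewrite Hg ifF //; have := ltn_ord i; lia.
(* $[k+1]_q$ is palindromic of degree k: the exponent i is exchanged with k - i. *)
rewrite coefq (reindex_inj rev_ord_inj) /=; apply: eq_bigr => i _.
have lt_ik := ltn_ord i; rewrite Hg.
rewrite subSS; case: (leqP (k - i) d) => le_id /=.
  case: (leqP (d - (k - i)) D) => le_D /=; last by rewrite ifT //; lia.
  by rewrite ifF; [congr (f`_ _) |]; lia.
by case: ifP => // ?; rewrite Hf //; lia.
Qed.

Lemma hdim0 n k d : (n < k)%N || (k == 0%N) && (0 < n)%N -> hdim n k d = 0%N.
Proof.
elim: n k d => [|n IH] [|k] d //= lt_nk.
by rewrite big1 // => i _; rewrite !IH ?if_same //; lia.
Qed.

Lemma stirq0 n k : (n < k)%N || (k == 0%N) && (0 < n)%N -> stirq n k = 0.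
Proof.
elim: n k => [|n IH] [|k] //= lt_nk.
by rewrite !IH ?mulr0 ?addr0 //; lia.
Qed.

(** This constant term becomes the leading coefficient of $[k]!_q\mathrm{Stir}_q(n,k)$, so that the
    degree bound D is attained. *)
Lemma hdim_d0 n k : (k <= n)%N -> (0 < k)%N || (n == 0%N) -> hdim n k 0 = 1%N.
Proof.
elim: n k => [|n IH] [|k] //= le_kn _.
rewrite (bigD1 ord0) //= big1 ?addn0 => [|i /andP[i0 ne_i0]]; last first.
  by case/negP: ne_i0; rewrite -val_eqE /= -leqn0.
rewrite leqn0 subn_eq0; have [lt_nk|le_nk] := leqP n k; last first.
  by rewrite IH //; lia.
by rewrite hdim0 ?sub0n ?IH //; lia.
Qed.

Lemma isrev_qfact_stirq n k : (k <= n)%N -> (0 < k)%N || (n == 0%N) ->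
  isrev ('C(k, 2) + k.-1 * (n - k)) (qfact k * stirq n k) (hdim n k).
Proof.
elim: n k => [|n IH] [|k] //= le_kn _.
  by rewrite /qfact big_ord0 mul1r; split=> [[|e]|[|d]]; rewrite ?coef1.
have -> : qfact k.+1 * (stirq n k + qint k.+1 * stirq n k.+1) =
    qint k.+1 * (qfact k.+1 * stirq n k.+1 + qfact k * stirq n k).
  by rewrite /qfact big_ord_recr /=; ring.
(* The summand with [stirq n k.+1] has degree bound $\binom k2 + k(n-k)$; for k > 0 the other bound
   is smaller by n - k, whence its shift. The factor $[k+1]_q$ adds k. *)
have -> : ('C(k.+1, 2) + k * (n.+1 - k.+1) = 'C(k, 2) + k * (n - k) + k)%N.
  by rewrite binS bin1; lia.
pose g d := (if n - k <= d then hdim n k (d - (n - k)) else 0)%N.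
apply: (@isrev_qint _ _ _ (fun d => hdim n k.+1 d + g d)%N); apply: isrevD.
  have [lt_kn|le_nk] := ltnP k n.
    have := IH k.+1 lt_kn isT; congr isrev; rewrite binS bin1 /= subnS.
    by have : (0 < n - k)%N; [lia | case: (n - k)%N => // m _; lia].
  by rewrite stirq0 ?mulr0; [apply: isrev0 => d; rewrite hdim0 |]; lia.
(* At k = 0 < n the predecessor [k.-1] is truncated, but then Stir(n,0) = 0. *)
have [/andP[k0 n_gt0]|/negbTE nk0] := boolP ((k == 0%N) && (0 < n)%N).
  by rewrite stirq0 ?mulr0; [apply: isrev0 => d; rewrite /g hdim0 ?if_same |]; lia.
have -> : ('C(k, 2) + k * (n - k) = 'C(k, 2) + k.-1 * (n - k) + (n - k))%N.
  by case: (k) nk0 => [|k'] /= nk0; lia.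
by apply: isrev_shift; apply: IH; lia.
Qed.

Lemma revq_qfact_stirq n k d : (0 < k <= n)%N ->
  (revq (qfact k * stirq n k))`_d = (hdim n k d)%:Z.
Proof.
case/andP=> k_gt0 le_kn; set f := _ * _.
have [Hf Hg] : isrev ('C(k, 2) + k.-1 * (n - k)) f (hdim n k).
  by apply: isrev_qfact_stirq; rewrite ?k_gt0.
set D := ('C(k, 2) + _)%N in Hf Hg.
have size_f : size f = D.+1.
  apply/eqP; rewrite eqn_leq; apply/andP; split; first by apply/leq_sizeP => e /Hf.
  rewrite ltnNge; apply/negP => /leq_sizeP/(_ D (leqnn D)) f_D0.
  by have := Hg 0%N; rewrite subn0 f_D0 hdim_d0 ?k_gt0.
by rewrite /revq size_f coef_poly Hg ltnS subn1.
Qed.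

(** * The number k! Stir(n,k), value of $g_{n,k}$ at q = 1 *)

Fixpoint zcount (n k : nat) : nat :=
  match n, k with
  | 0, 0 => 1
  | n'.+1, k'.+1 => k * (zcount n' k + zcount n' k')
  | _, _ => 0
  end%N.

Lemma sum_shift (a : nat -> nat) M i :
  (\sum_(d < M | i <= d) a (d - i) = \sum_(d < M - i) a d)%N.
Proof.
elim: M => [|M IH]; first by rewrite !big_ord0.
rewrite big_mkcond big_ord_recr -big_mkcond /= IH.
case: leqP => [le_iM|lt_Mi]; first by rewrite subSn // big_ord_recr.
by rewrite addn0; have -> : (M.+1 - i = M - i)%N by lia.
Qed.

(** Partial sums of nonnegative coefficients stay below the value at q = 1; the shifts by $q^i$ and
    $q^{n-k}$ only shorten the range of summation. *)
Lemma sum_hdim_le n k M : (\sum_(d < M) hdim n k d <= zcount n k)%N.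
Proof.
elim: n k M => [|n IH] [|k] M /=; try by rewrite big1.
  case: M => [|M]; first by rewrite big_ord0.
  by rewrite big_ord_recl big1.
rewrite (exchange_big_dep predT) //= -[X in (_ <= X * _)%N]card_ord -sum_nat_const.
apply: leq_sum => i _.
rewrite (sum_shift (fun d => hdim n k.+1 d + if n - k <= d then hdim n k (d - (n - k)) else 0)%N).
rewrite big_split leq_add //=; first exact: IH.
by rewrite -big_mkcond (sum_shift (hdim n k)); apply: IH.
Qed.

(** * Coefficient functions and polynomials *)

Section Coefficients.
Variables (F : fieldType) (n : nat).
Implicit Types (p q g : {mpoly F[n]}) (s : seq 'I_n) (m : 'X_{1..n}).

Definition vars s : seq {mpoly F[n]} := [seq 'X_i | i <- s].

Definition xvars := vars (enum 'I_n).

Definition mnm_of (a : 'I_n -> nat) : 'X_{1..n} := [multinom a i | i < n].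

(** Passes from polynomials to the coefficient functions in which [Jdeg] is expressed. *)
Definition cfun p : mpolyF F n := fun a => p@_(mnm_of a).

Definition vanishes_off s m := [forall l, (l \notin s) ==> (m l == 0%N)].

Lemma mcoeffXM (u : 'X_{1..n}) p m :
  ('X_[u] * p)@_m = if (u <= m)%MM then p@_(m - u) else 0.
Proof.
rewrite mulrC; case: ifP => [le_um|/negbT nle_um].
  by rewrite -{1}(submK le_um) addmC mcoeffMX.
apply/eqP; rewrite mcoeff_eq0 (perm_mem (msuppMX p u)).
by apply: contra nle_um => /mapP[m' _ ->]; apply: lem_addr.
Qed.

Lemma mcoeffXiM i p m :
  ('X_i * p)@_m = if (0 < m i)%N then p@_(m - U_(i)) else 0.
Proof.
rewrite mcoeffXM; congr (if _ then _ else _); apply/mnm_lepP/idP => [/(_ i)|m_i l].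
  by rewrite mnm1E eqxx.
by rewrite mnm1E; case: eqP => // <-.
Qed.

Lemma vanishes_off0 s : vanishes_off s 0%MM.
Proof. by apply/forallP => l; rewrite mnm0E eqxx implybT. Qed.

Lemma mdeg0_vanishes_off s m : (mdeg m == 0%N) && vanishes_off s m = (m == 0%MM).
Proof.
by rewrite mdeg_eq0; case: eqP => //= ->; rewrite vanishes_off0.
Qed.

Lemma vanishes_off_nil m : vanishes_off [::] m = (m == 0%MM).
Proof.
apply/forallP/eqP => [m0|->]; last by move=> l; rewrite mnm0E.
by apply/mnmP => l; rewrite mnm0E; apply/eqP; apply: m0.
Qed.

Lemma vanishes_off_cons0 i s m : m i = 0%N ->
  vanishes_off (i :: s) m = vanishes_off s m.
Proof.
move=> m_i; apply/forallP/forallP => Hm l; move: (Hm l); rewrite inE ?negb_or.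
  by case: (eqVneq l i) => [->|]; rewrite ?m_i ?eqxx ?implybT.
by case: (eqVneq l i).
Qed.

Lemma vanishes_offN i s m : i \notin s -> (0 < m i)%N -> vanishes_off s m = false.
Proof.
move=> i_s m_i; apply/negbTE/forallPn; exists i.
by rewrite i_s -lt0n.
Qed.

Lemma mdegBU i m : (0 < m i)%N -> mdeg m = (mdeg (m - U_(i))).+1.
Proof.
move=> m_i; rewrite -addn1 -(mdeg1 i) -mdegD submK //.
by apply/mnm_lepP => l; rewrite mnm1E; case: eqP => // <-.
Qed.

Lemma mcoeff_hsymf s j m : uniq s ->
  (hsymf (vars s) j)@_m = ((mdeg m == j) && vanishes_off s m)%:R.
Proof.
elim: s j m => [|i s IHs] j m.
  rewrite vanishes_off_nil /hsymf; case: j => [|j] _; rewrite /= ?mcoeff0 ?mcoeff1.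
    by rewrite mdeg_eq0 andbb.
  by case: (eqVneq m 0%MM) => [->|_]; rewrite ?andbF ?mdeg0.
move=> /andP[i_s uniq_s]; elim: j m => [|j IHj] m.
  by rewrite hsymf0 mcoeff1 mdeg0_vanishes_off.
rewrite -[vars _]/('X_i :: vars s) hsymfS mcoeffD IHs // mcoeffXiM IHj.
(* If $x_i$ does not divide m only the first summand contributes, otherwise only the second, at
   $m/x_i$. *)
case: (posnP (m i)) => [m_i|m_i] /=; first by rewrite addr0 vanishes_off_cons0.
rewrite (vanishes_offN i_s m_i) andbF add0r (mdegBU m_i) eqSS.
congr ((_ && _)%:R); apply: eq_forallb => l; rewrite mnmBE mnm1E inE negb_or.
by case: (eqVneq l i) => [->|_] /=; rewrite ?subn0 // !eqxx.
Qed.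

Lemma mcoeff_esymf s j m : uniq s ->
  (esymf (vars s) j)@_m = ([forall l, (m l <= 1)%N] && (mdeg m == j) && vanishes_off s m)%:R.
Proof.
have le1_0 : [forall l : 'I_n, (0%MM : 'X_{1..n}) l <= 1]%N.
  by apply/forallP => l; rewrite mnm0E.
elim: s j m => [|i s IHs] [|j] m.
- rewrite /= mcoeff1 -andbA mdeg0_vanishes_off.
  by case: (eqVneq m 0%MM) => [->|_]; rewrite ?andbF ?le1_0.
- rewrite /= mcoeff0 vanishes_off_nil.
  by case: (eqVneq m 0%MM) => [->|_]; rewrite ?andbF // mdeg0 andbF.
- rewrite /= mcoeff1 -andbA mdeg0_vanishes_off.
  by case: (eqVneq m 0%MM) => [->|_]; rewrite ?andbF ?le1_0.
move=> /andP[i_s uniq_s].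
rewrite /= mcoeffD IHs // mcoeffXiM IHs //.
case: (posnP (m i)) => [m_i|m_i] /=; first by rewrite addr0 vanishes_off_cons0.
rewrite (vanishes_offN i_s m_i) andbF add0r (mdegBU m_i) eqSS.
congr ((nat_of_bool _)%:R); apply/idP/idP => [/andP[/andP[/forallP le1 deg_m] /forallP off_s]|].
  have mE l : m l = ((m - U_(i))%MM l + (i == l))%N.
    rewrite mnmBE mnm1E; case: eqP => [<-|_]; last by rewrite subn0 addn0.
    by rewrite subnK.
  have m'_i : (m - U_(i))%MM i = 0%N by apply/eqP; move: (off_s i); rewrite i_s.
  rewrite deg_m andbT; apply/andP; split; apply/forallP => l.
    by rewrite mE; case: eqP => [<-|_]; rewrite ?m'_i // addn0.
  rewrite inE negb_or mE; apply/implyP => /andP[/negbTE ne_li l_s].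
  by move: (off_s l); rewrite l_s (eq_sym i) ne_li addn0.
move=> /andP[/andP[/forallP le1 ->] /forallP off_s]; rewrite andbT.
apply/andP; split; apply/forallP => l; rewrite mnmBE mnm1E.
  exact: leq_trans (leq_subr _ _) (le1 l).
apply/implyP => l_s; case: (eqVneq i l) => [<-|ne_il]; first by rewrite subn_eq0.
by move: (off_s l); rewrite inE negb_or (eq_sym l) ne_il l_s subn0.
Qed.

Lemma mem_take_enum_ord i (l : 'I_n) : (l \in take i (enum 'I_n)) = (l < i)%N.
Proof. by rewrite in_take ?mem_enum // index_enum_ord. Qed.

Lemma cfun_hsymf k i : cfun (hsymf (take i xvars) k) =1 @hpoly F n k i.
Proof.
move=> a; rewrite /cfun /hpoly /xvars /vars -map_take.
rewrite mcoeff_hsymf ?take_uniq ?enum_uniq // mdegE.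
rewrite (eq_bigr a) => [|l _]; last by rewrite mnmE.
have -> : vanishes_off (take i (enum 'I_n)) (mnm_of a) =
    [forall j : 'I_n, (i <= j)%N ==> (a j == 0%N)].
  by apply: eq_forallb => l; rewrite mem_take_enum_ord mnmE -leqNgt.
by case: ifP.
Qed.

Lemma cfun_esymf j : cfun (esymf xvars j) =1 @epoly F n j.
Proof.
move=> a; rewrite /cfun /epoly mcoeff_esymf ?enum_uniq // mdegE.
rewrite (eq_bigr a) => [|l _]; last by rewrite mnmE.
have -> : vanishes_off (enum 'I_n) (mnm_of a).
  by apply/forallP => l; rewrite mem_enum.
have -> : [forall l, (mnm_of a l <= 1)%N] = [forall l, (a l <= 1)%N].
  by apply: eq_forallb => l; rewrite mnmE.
by rewrite andbT; case: ifP.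
Qed.

Lemma mulmon_cfun (a : 'I_n -> nat) p (f : mpolyF F n) :
  cfun p =1 f -> cfun ('X_[mnm_of a] * p) =1 mulmon a f.
Proof.
move=> pf b; rewrite /cfun mcoeffXM /mulmon -pf.
congr (if _ then _ else _); last first.
  by congr (p@_ _); apply/mnmP => i; rewrite mnmBE !mnmE.
by apply/mnm_lepP/forallP => le_ab i; have := le_ab i; rewrite !mnmE.
Qed.

Lemma eq_comp d (f f' : mpolyF F n) : f =1 f' -> Defs.comp d f = Defs.comp d f'.
Proof. by move=> eqf; apply/rowP => i; rewrite !mxE. Qed.

Lemma comp_cfun_lin d (c : F) p q :
  Defs.comp d (cfun (c *: p + q)) = c *: Defs.comp d (cfun p) + Defs.comp d (cfun q).
Proof. by apply/rowP => i; rewrite !mxE /cfun mcoeffD mcoeffZ. Qed.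

Lemma comp_cfun0 d : Defs.comp d (cfun 0) = 0.
Proof. by apply/rowP => i; rewrite !mxE /cfun mcoeff0. Qed.

(** Exponents in degree d are at most d, so the finite type [mon n d] contains every monomial of
    that degree. *)
Lemma mon_of_mnm d m : mdeg m = d -> exists u : mon n d, mnm_of (expo u) = m.
Proof.
move=> deg_m.
have lt_m i : (m i < d.+1)%N by rewrite ltnS -deg_m mdegE (bigD1 i) //= leq_addr.
pose f := [ffun i => Ordinal (lt_m i)].
have Hf : (\sum_(i < n) (f i : nat))%N == d.
  apply/eqP; rewrite -[RHS]deg_m mdegE; apply: eq_bigr => i _.
  by rewrite ffunE.
exists (exist _ f Hf); apply/mnmP => i.
by rewrite mnmE /expo /= ffunE.
Qed.

Lemma mdeg_mon d (u : mon n d) : mdeg (mnm_of (expo u)) = d.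
Proof.
rewrite mdegE -[RHS](eqP (valP u)); apply: eq_bigr => i _.
by rewrite mnmE.
Qed.

Lemma mnm_of_expo_inj d : injective (fun u : mon n d => mnm_of (expo u)).
Proof.
move=> u v /mnmP eq_uv; apply/val_inj/ffunP => i; apply: val_inj.
by have := eq_uv i; rewrite !mnmE.
Qed.

Lemma dhomog_homg d p : homg xvars d p -> p \is d.-homog.
Proof.
elim=> {d p} [|d|d c p q _ hp _ hq|d x p].
- exact: dhomog1.
- exact: dhomog0.
- by apply: dhomogD => //; apply: dhomogZ.
- by case/mapP=> i _ -> _ hp; rewrite -add1n; apply: dhomogM => //; rewrite dhomogX /= mdeg1.
Qed.

Lemma homg_mnm m : homg xvars (mdeg m) 'X_[m].
Proof.
rewrite mpolyXE_id mdegE.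
elim/big_rec2: _ => [|i d p _ hp]; first exact: homg_1.
by apply: homgM => //; apply: homgXn; apply: map_f; rewrite mem_enum.
Qed.

Lemma size_xvars : size xvars = n.
Proof. by rewrite size_map size_enum_ord. Qed.

Lemma comp_mul_submx (N : nat) d e g (V : 'M[F]_(N, #|{: mon n (d + e)}|)) :
  (forall u : mon n d, (Defs.comp (d + e) (cfun ('X_[mnm_of (expo u)] * g)) <= V)%MS) ->
  forall c, c \is d.-homog -> (Defs.comp (d + e) (cfun (c * g)) <= V)%MS.
Proof.
move=> HV c /dhomogP hc; rewrite [c]mpolyE mulr_suml big_seq.
elim/big_rec: _ => [|m p m_c hp]; first by rewrite comp_cfun0 sub0mx.
rewrite -scalerAl comp_cfun_lin addmx_sub ?scalemx_sub //.
by have [u <-] := mon_of_mnm (hc _ m_c); apply: HV.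
Qed.

Lemma Jdeg_gen k d e g (u : mon n d) : (k <= n)%N -> gensJ xvars k e g ->
  (Defs.comp (d + e) (cfun ('X_[mnm_of (expo u)] * g)) <= Jdeg F n k (d + e))%MS.
Proof.
move=> le_kn; rewrite /Jdeg /Jgens big_cat !big_map /gensJ size_xvars.
have gen_sub (f : mpolyF F n) : cfun g =1 f ->
    (Defs.comp (d + e) (cfun ('X_[mnm_of (expo u)] * g)) <=
     \sum_(m : mon n (d + e - e)) <<Defs.comp (d + e) (mulmon (expo m) f)>>)%MS.
  move=> gf; rewrite addnK (sumsmx_sup u) // genmxE.
  by rewrite (eq_comp _ (mulmon_cfun _ gf)).
case=> [[def_e [i /andP[i_gt0 le_in] def_g]]|[lt_n def_g]].
  apply: submx_trans (addsmxSl _ _).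
  rewrite (big_rem i) /=; last by rewrite mem_iota; lia.
  apply: submx_trans (addsmxSl _ _); rewrite -def_e leq_addl; apply: gen_sub.
  by rewrite def_g def_e; apply: cfun_hsymf.
(* [gensJ] also admits e > n, outside the list [Jgens], but there the elementary symmetric function
   is 0. *)
have [lt_ne|le_en] := ltnP n e.
  rewrite def_g esymf_small ?size_xvars // mulr0 comp_cfun0.
  exact: sub0mx.
apply: submx_trans (addsmxSr _ _).
rewrite (big_rem e) /=; last by rewrite mem_iota; lia.
apply: submx_trans (addsmxSl _ _); rewrite leq_addl; apply: gen_sub.
by rewrite def_g; apply: cfun_esymf.
Qed.

Lemma idl_Jdeg k d p : (k <= n)%N -> idl xvars (gensJ xvars k) d p ->
  (Defs.comp d (cfun p) <= Jdeg F n k d)%MS.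
Proof.
move=> le_kn; elim=> {d p} [d|d e c g p Gg hc _ IH].
  by rewrite comp_cfun0 sub0mx.
rewrite -[c * g]scale1r comp_cfun_lin scale1r addmx_sub //.
by apply: comp_mul_submx (dhomog_homg hc) => u; apply: Jdeg_gen.
Qed.

Lemma lspan_rows d (B : seq {mpoly F[n]}) p : lspan B p ->
  (Defs.comp d (cfun p) <= \matrix_(i < size B) Defs.comp d (cfun B`_i))%MS.
Proof.
elim=> {p} [|c b p bB _ IH]; first by rewrite comp_cfun0 sub0mx.
rewrite comp_cfun_lin addmx_sub ?scalemx_sub //.
have lt_b : (index b B < size B)%N by rewrite index_mem.
rewrite (eq_row_sub (Ordinal lt_b)) // rowK /=.
by rewrite nth_index.
Qed.

(** Every monomial lies in the sum of $J_d$ and the span of B, so dim $R_d$ is at most the rank of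
    $J_d$ plus the size of B. *)
Lemma hilbS_le_hdim k d : (k <= n)%N -> (hilbS F n k d <= hdim n k d)%N.
Proof.
move=> le_kn; have [B sizeB covB] := covers_gensJ xvars k d.
rewrite size_xvars in sizeB; rewrite /hilbS leq_subLR.
set MB := \matrix_(i < size B) Defs.comp d (cfun B`_i).
apply: leq_trans (_ : \rank (Jdeg F n k d) + \rank MB <= _)%N; last first.
  by rewrite leq_add2l (leq_trans (rank_leq_row _)).
rewrite -{1}(mxrank1 F #|{: mon n d}|).
apply: leq_trans (mxrank_adds_leqif _ _); apply: mxrankS.
apply/row_subP => i.
have := homg_mnm (mnm_of (expo (enum_val i))); rewrite mdeg_mon => /covB[b hb hJ].
have -> : row i 1%:M = Defs.comp d (cfun 'X_[mnm_of (expo (enum_val i))]) :> 'rV[F]_ _.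
  apply/rowP => j; rewrite !mxE /cfun mcoeffX (inj_eq (@mnm_of_expo_inj _)).
  by rewrite (inj_eq enum_val_inj).
rewrite -(subrK b 'X_[_]) -[_ - b]scale1r comp_cfun_lin scale1r addmx_sub_adds //.
  exact: idl_Jdeg.
exact: lspan_rows.
Qed.

End Coefficients.

(** * The point locus *)

Section Points.
Variable K : fieldType.
Implicit Types (L : nat -> K) (z u w : seq K).

(* Points with distinct coordinates z_i (i < n) in {L 0, ..., L (k + i - 1)}
   that use all of L 0, ..., L (k - 1).  After choosing z_0 = L j, the remaining
   coordinates either use or avoid the new k-th value L (bump j k.-1). *)
Fixpoint pts (n k : nat) L : seq (seq K) :=
  match n, k with
  | 0, 0 => [:: [::]]
  | n'.+1, k'.+1 => flatten [seq [seq L j :: z |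
        z <- pts n' k (L \o bump j) ++ pts n' k' (L \o bump j \o bump k')] | j <- iota 0 k]
  | _, _ => [::]
  end.

Lemma size_pts n k L : size (pts n k L) = zcount n k.
Proof.
elim: n k L => [|n IH] [|k] L //.
rewrite size_flatten /shape -map_comp sumnE big_map.
rewrite -[iota _ _]/(index_iota 0 k.+1) big_mkord.
rewrite (eq_bigr (fun=> zcount n k.+1 + zcount n k)%N) => [|i _].
  by rewrite sum_nat_const card_ord.
by rewrite /= size_map size_cat !IH.
Qed.

Lemma bump_inj h : injective (bump h).
Proof. exact: can_inj (bumpK h). Qed.

Lemma pts_spec n k L z : injective L -> z \in pts n k L ->
  [/\ size z = n, uniq z,
      forall i, (i < n)%N -> exists2 l, (l < k + i)%N & nth 0 z i = L l &
      forall l, (l < k)%N -> L l \in z].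
Proof.
elim: n k L z => [|n IH] [|k] L z // injL.
  by rewrite inE => /eqP->.
case/flatten_mapP=> j; rewrite mem_iota /= add0n => lt_jk /mapP[{}z + ->].
(* [bump j] skips j, so [L \o bump j] enumerates the values left after $z_0 = L_j$; [consP] restores
   the conditions for the whole point. *)
have injLj : injective (L \o bump j) by apply: inj_comp injL (@bump_inj j).
have consP : size z = n -> uniq z ->
    (forall i, (i < n)%N -> exists2 l, (l < k.+1 + i)%N & nth 0 z i = L (bump j l)) ->
    (forall l, (l < k.+1)%N -> l != j -> L l \in z) ->
  [/\ size (L j :: z) = n.+1, uniq (L j :: z),
      forall i, (i < n.+1)%N -> exists2 l, (l < k.+1 + i)%N & nth 0 (L j :: z) i = L l &
      forall l, (l < k.+1)%N -> L l \in L j :: z].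
  move=> sz uz Hz Lz; split.
  - by rewrite /= sz.
  - rewrite /= uz andbT; apply/negP => /(nthP 0)[i]; rewrite sz => /Hz[l _ ->].
    by move/injL; rewrite /bump; lia.
  - case=> [|i] lt_i /=; first by exists j; rewrite ?addn0.
    by have [l lt_l ->] := Hz i lt_i; exists (bump j l); rewrite // /bump; lia.
  - move=> l lt_lk; rewrite inE; case: (eqVneq l j) => [->|ne_lj]; first by rewrite eqxx.
    by rewrite Lz ?orbT.
rewrite mem_cat => /orP[] Hz.
  have [sz uz H1 H2] := IH _ _ _ injLj Hz; apply: consP => // l lt_l ne_lj.
  have -> : l = bump j (unbump j l) by rewrite unbumpK.
  by apply: H2; rewrite /unbump; lia.
have injLjk : injective (L \o bump j \o bump k) by apply: inj_comp injLj (@bump_inj k).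
have [sz uz H1 H2] := IH _ _ _ injLjk Hz; apply: consP => // [i lt_i|l lt_l ne_lj].
  by have [l lt_l ->] := H1 i lt_i; exists (bump k l); rewrite // /bump; lia.
have lt_ul : (unbump j l < k)%N by rewrite /unbump; lia.
have := H2 _ lt_ul; rewrite /= [bump k _]/bump leqNgt lt_ul add0n.
by rewrite unbumpK.
Qed.

Lemma uniq_pts n k L : injective L -> uniq (pts n k L).
Proof.
elim: n k L => [|n IH] [|k] L // injL.
have injLj j : injective (L \o bump j) by apply: inj_comp injL (@bump_inj j).
have injLjk j : injective (L \o bump j \o bump k) by apply: inj_comp (injLj j) (@bump_inj k).
apply: allpairs_uniq_dep => [|j|]; first exact: iota_uniq; last first.
  by move=> [j z] [j' z'] _ _ /= [/injL<- <-].
rewrite mem_iota => /= lt_j; rewrite cat_uniq !IH ?andbT //=.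
(* The two families are disjoint: points of the first contain the k-th value of [L \o bump j], which
   the second skips. *)
apply/hasPn => z /(pts_spec (injLjk j))[sz _ Hz _].
apply: contraL (erefl true) => /(pts_spec (injLj j))[_ _ _ /(_ k (leqnn _))].
case/(nthP 0) => i; rewrite sz => /Hz[l _ ->] /injLj.
by rewrite /bump; lia.
Qed.

(** Up to order w is [u ++ v] with v shorter than j, and $e_j(v) = 0$. This yields the relations
    that hold at the points. *)
Lemma hesum_sub u w j : uniq u -> uniq w -> {subset u <= w} ->
  (size w < size u + j)%N -> hesum u w j = 0.
Proof.
move=> uniq_u uniq_w sub_uw lt_w; pose v := [seq x <- w | x \notin u].
have eq_w : perm_eq w (u ++ v).
  apply: uniq_perm => //.
    rewrite cat_uniq uniq_u filter_uniq // andbT; apply/hasPn => x.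
    by rewrite mem_filter => /andP[].
  move=> x; rewrite mem_cat mem_filter.
  by case: (boolP (x \in u)) => [/sub_uw->|].
have -> : hesum u w j = hesum u (u ++ v) j.
  by apply: eq_bigr => i _; rewrite (perm_esymf eq_w).
by rewrite hesum_cat esymf_small //; move: lt_w; rewrite (perm_size eq_w) size_cat ltn_add2l.
Qed.

End Points.

(** * Evaluation at a finite set of points *)

Lemma rmorph_esymf (R S : comNzRingType) (f : {rmorphism R -> S}) s j :
  f (esymf s j) = esymf [seq f x | x <- s] j.
Proof.
elim: s j => [|x s IH] [|j] /=; rewrite ?rmorph1 ?rmorph0 //.
by rewrite rmorphD rmorphM !IH.
Qed.

Lemma rmorph_hsymf (R S : comNzRingType) (f : {rmorphism R -> S}) s j :
  f (hsymf s j) = hsymf [seq f x | x <- s] j.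
Proof.
elim: s j => [|x s IH] j; first by rewrite /hsymf rmorph_nat.
elim: j => [|j IHj]; first by rewrite !hsymf0 rmorph1.
by rewrite map_cons !hsymfS rmorphD rmorphM IHj IH.
Qed.

Lemma dhomog_expand (F : fieldType) n d (p : {mpoly F[n]}) : p \is d.-homog ->
  p = \sum_(u : mon n d) p@_(mnm_of (expo u)) *: 'X_[mnm_of (expo u)].
Proof.
move=> hp; apply/mpolyP => m; rewrite raddf_sum /=.
under eq_bigr do rewrite mcoeffZ mcoeffX.
have [deg_m|ne_m] := eqVneq (mdeg m) d.
  have [u def_m] := mon_of_mnm deg_m; rewrite (bigD1 u) //= def_m eqxx mulr1.
  rewrite big1 ?addr0 // => v ne_vu; rewrite -def_m (inj_eq (@mnm_of_expo_inj _ _)).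
  by rewrite (negbTE ne_vu) mulr0.
rewrite (dhomog_nemf_coeff hp ne_m) big1 // => u _.
by case: eqP => [def_m|]; rewrite ?mulr0 //; rewrite -def_m mdeg_mon eqxx in ne_m.
Qed.

Section Evaluation.
Variables (K : fieldType) (n : nat) (Z : seq (seq K)).
Implicit Types (p q : {mpoly K[n]}) (r : 'I_(size Z)).

Definition pt r : 'I_n -> K := fun i => nth 0 (nth [::] Z r) i.

Definition evrow p : 'rV[K]_(size Z) := \row_r p.@[pt r].

Definition EV d : 'M[K]_(#|{: mon n d}|, size Z) :=
  \matrix_j evrow 'X_[mnm_of (expo (enum_val j))].

(** The value vectors on Z of polynomials of degree less than D; they filter $K^Z$. *)
Definition Vlow D : 'M[K]_(size Z) := (\sum_(d < D) <<EV d>>)%MS.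

Lemma evrow_lin c p q : evrow (c *: p + q) = c *: evrow p + evrow q.
Proof. by apply/rowP => r; rewrite !mxE mevalD mevalZ. Qed.

Lemma evrow0 : evrow 0 = 0.
Proof. by apply/rowP => r; rewrite !mxE meval0. Qed.

Lemma comp_mul_EV d p : p \is d.-homog -> Defs.comp d (cfun p) *m EV d = evrow p.
Proof.
move=> hp; apply/rowP => r; rewrite !mxE {2}(dhomog_expand hp) raddf_sum /=.
rewrite (reindex (@enum_val (mon n d) predT)) /=; last first.
  by apply: onW_bij; apply: enum_val_bij.
by apply: eq_bigr => j _; rewrite !mxE mevalZ.
Qed.

Lemma evrow_low D p : (msize p <= D)%N -> (evrow p <= Vlow D)%MS.
Proof.
move=> low_p; rewrite [p]mpolyE big_seq.
elim/big_rec: _ => [|m q m_p hq]; first by rewrite evrow0 sub0mx.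
rewrite evrow_lin addmx_sub ?scalemx_sub //.
have lt_mD : (mdeg m < D)%N by apply: leq_trans (msize_mdeg_lt m_p) low_p.
rewrite /Vlow (sumsmx_sup (Ordinal lt_mD)) // genmxE.
have [u def_m] := mon_of_mnm (erefl (mdeg m)).
by rewrite (eq_row_sub (enum_rank u)) // rowK enum_rankK def_m.
Qed.

Lemma evrow_mul_ext m p q : evrow p = evrow q -> evrow ('X_[m] * p) = evrow ('X_[m] * q).
Proof.
move=> /rowP eq_pq; apply/rowP => r; rewrite !mxE !mevalM.
by have := eq_pq r; rewrite !mxE => ->.
Qed.

(* Lagrange interpolation at the points of Z. *)
Lemma Vlow_full D : uniq Z -> {in Z, forall z, size z = n} ->
  (size Z <= D)%N -> \rank (Vlow D) = size Z.
Proof.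
move=> uniqZ sizeZ le_ZD; apply/eqP; rewrite -[_ == _]/(row_full (Vlow D)) -sub1mx.
apply/row_subP => r.
suff [p low_p ev_p] : exists2 p, (msize p <= D)%N & evrow p = row r 1%:M.
  by rewrite -ev_p; apply: evrow_low.
have lagrange (S : seq 'I_(size Z)) : r \notin S -> exists p,
    [/\ (msize p <= (size S).+1)%N, p.@[pt r] = 1 & {in S, forall r', p.@[pt r'] = 0}].
  elim: S => [|r' S IH]; first by move=> _; exists 1; rewrite msize1 meval1.
  rewrite inE negb_or => /andP[ne_r /IH[p [low_p pr pS]]].
  have [i ne_i] : exists i, pt r i != pt r' i.
    apply/existsP; apply: contraNT ne_r; rewrite negb_exists => /forallP eq_pt.
    apply/eqP/val_inj/eqP; rewrite /= -(nth_uniq [::] _ _ uniqZ) //; apply/eqP.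
    have sz (l : 'I_(size Z)) : size (nth [::] Z l) = n by apply/sizeZ/mem_nth.
    apply: (@eq_from_nth _ 0) => [|i]; rewrite !sz // => lt_i.
    by have /negbNE/eqP := eq_pt (Ordinal lt_i).
  (* A factor of degree at most 1 that is 1 at [pt r] and 0 at [pt r']. *)
  set q := (pt r i - pt r' i)^-1 *: ('X_i - (pt r' i)%:MP).
  have qr : (q * p).@[pt r] = 1.
    by rewrite mevalM mevalZ mevalB mevalXU mevalC pr mulr1 mulVf // subr_eq0.
  exists (q * p); split=> //.
  - have /andP[q0 p0] : (q != 0) && (p != 0).
      rewrite -negb_or -mulf_eq0; apply/eqP => qp0.
      by move/eqP: qr; rewrite qp0 meval0 eq_sym oner_eq0.
    have low_q : (msize q <= 2)%N.
      apply: leq_trans (msizeZ_le _ _) _; apply: leq_trans (msizeD_le _ _) _.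
      by rewrite msizeN msizeX mdeg1 msizeC; case: (_ != 0).
    by rewrite msizeM //= -subn1 leq_subLR (leq_trans (leq_add low_q low_p)).
  - move=> r''; rewrite inE mevalM mevalZ mevalB mevalXU mevalC.
    case/predU1P=> [->|/pS->]; last by rewrite mulr0.
    by rewrite subrr mulr0 mul0r.
have [|p [low_p pr p0]] := lagrange [seq r' <- enum 'I_(size Z) | r' != r].
  by rewrite mem_filter eqxx.
exists p.
  apply: leq_trans low_p _; rewrite -[X in size X]rem_filter ?enum_uniq //.
  rewrite size_rem ?mem_enum // size_enum_ord.
  by rewrite prednK // (leq_ltn_trans (leq0n r)).
apply/rowP => r'; rewrite !mxE; case: (eqVneq r r') => [<-//|ne_r].
by rewrite p0 // mem_filter mem_enum eq_sym ne_r.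
Qed.

Lemma gensJ_dhomog k e g : gensJ (xvars K n) k e g -> g \is e.-homog.
Proof.
case=> [[-> [i _ ->]]|[_ ->]]; apply: dhomog_homg; last exact: homg_esymf.
by apply: homg_subset (homg_hsymf _ _) => y /mem_take.
Qed.

Lemma msizeXM_le (m : 'X_{1..n}) q : (msize ('X_[m] * q) <= mdeg m + msize q)%N.
Proof.
have [->|q0] := eqVneq q 0; first by rewrite mulr0 msize0.
rewrite msizeM //; first by rewrite msizeX.
by rewrite -msize_poly_eq0 msizeX.
Qed.

Lemma msize_lincomb D (I : finType) (c : I -> K) (p : I -> {mpoly K[n]}) :
  (forall i, exists2 d, (d < D)%N & p i \is d.-homog) ->
  (msize (\sum_i c i *: p i) <= D)%N.
Proof.
move=> hp; elim/big_ind: _ => [|q q' hq hq'|i _]; first by rewrite msize0.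
  by apply: leq_trans (msizeD_le _ _) _; rewrite geq_max hq.
apply: leq_trans (msizeZ_le _ _) _; have [d lt_dD /dhomogP hd] := hp i.
rewrite msizeE big_seq; elim/big_ind: _ => // [x y hx hy|m /hd->//].
by rewrite geq_max hx.
Qed.

(** If each generator agrees on Z with a polynomial of lower degree, then $J_D$ adds no values
    beyond [Vlow D]. Passing to D + 1 thus raises the rank by at most dim $(S_{n,k})_D$. *)
Lemma rank_Vlow_le (F : fieldType) (f : {rmorphism F -> K}) k D :
  (forall e g, gensJ (xvars K n) k e g -> exists2 q, (msize q <= e)%N & evrow g = evrow q) ->
  (\rank (Vlow D) <= \sum_(d < D) hilbS F n k d)%N.
Proof.
move=> Hg; elim: D => [|D IH]; first by rewrite /Vlow !big_ord0 mxrank0.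
rewrite /Vlow !big_ord_recr /= -/(Vlow D).
set A := map_mx f (Jdeg F n k D).
have rankA : \rank A^C%MS = hilbS F n k D by rewrite mxrank_compl mxrank_map.
have JEV : (A *m EV D <= Vlow D)%MS.
  (* P is stable under sums, so only monomial multiples of generators matter; there g is replaced by
     q, of lower degree. *)
  pose P (B : 'M[F]_#|{: mon n D}|) := (map_mx f B *m EV D <= Vlow D)%MS.
  have P0 : P 0 by rewrite /P map_mx0 mul0mx sub0mx.
  have PD B C : P B -> P C -> P (B + C)%MS.
    by move=> PB PC; rewrite /P (eqmxMr _ (map_addsmx f B C)) addsmxMr addsmx_sub; apply/andP.
  have Pgen e g (h : mpolyF F n) : gensJ (xvars K n) k e g -> cfun g =1 f \o h ->
      (e <= D)%N -> P (\sum_(u : mon n (D - e)) <<Defs.comp D (mulmon (expo u) h)>>)%MS.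
    move=> Gg gh le_eD; elim/big_ind: _ => // u _.
    rewrite /P (eqmxMr _ (map_genmx f _)) (eqmxMr _ (genmxE _)).
    have -> : map_mx f (Defs.comp D (mulmon (expo u) h)) =
        Defs.comp D (cfun ('X_[mnm_of (expo u)] * g)).
      apply/rowP => j; rewrite !mxE (mulmon_cfun _ gh) /mulmon /=.
      by case: ifP; rewrite ?rmorph0.
    have [q low_q eq_gq] := Hg e g Gg.
    move: (mnm_of _) (mdeg_mon u) => {u}m deg_m.
    rewrite comp_mul_EV; last first.
      rewrite -(subnK le_eD); apply: dhomogM; last exact: gensJ_dhomog Gg.
      by rewrite dhomogX /= deg_m.
    rewrite (evrow_mul_ext _ eq_gq); apply: evrow_low.
    by rewrite (leq_trans (msizeXM_le _ _)) // deg_m -{2}(subnK le_eD) leq_add2l.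
  rewrite /A -/(P _) /Jdeg /Jgens big_cat !big_map; apply: (PD); rewrite big_seq_cond.
    elim/big_ind: _ => // i; rewrite mem_iota /= => /andP[le_i le_kD].
    apply: (Pgen k (hsymf (take i (xvars K n)) k)) => //.
      by left; split=> //; exists i; rewrite // size_xvars; lia.
    by move=> a; rewrite cfun_hsymf /= /hpoly; case: ifP; rewrite ?rmorph1 ?rmorph0.
  elim/big_ind: _ => // j; rewrite mem_iota /= => /andP[le_j le_jD].
  apply: (Pgen j (esymf (xvars K n) j)) => //.
    by right; split=> //; rewrite size_xvars; lia.
  by move=> a; rewrite cfun_esymf /= /epoly; case: ifP; rewrite ?rmorph1 ?rmorph0.
(* A and its complement span all forms of degree D, and the values of A are already in [Vlow D]. *)
apply: leq_trans (_ : \rank (Vlow D + A^C *m EV D)%MS <= _)%N.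
  apply: mxrankS; rewrite addsmx_sub addsmxSl genmxE /=.
  have /submxP[X defX] : (1%:M <= A + A^C)%MS by rewrite sub1mx addsmx_compl_full.
  rewrite -[X in (X <= _)%MS]mul1mx; apply: submx_trans (_ : (A + A^C)%MS *m EV D <= _)%MS.
    by rewrite {1}defX -mulmxA submxMl.
  by rewrite addsmxMr addsmxS ?submx_refl.
apply: leq_trans (mxrank_adds_leqif _ _) _; rewrite leq_add //.
by rewrite -rankA mxrankM_maxl.
Qed.

End Evaluation.

(** * Lower bound for the total dimension *)

Section LowerBound.
Variables (K : fieldType) (n k : nat) (L : nat -> K).
Hypotheses (injL : injective L).
Let Z := pts n k L.

Let sizeZ : {in Z, forall z, size z = n}.
Proof. by move=> z /(pts_spec injL)[]. Qed.

Lemma meval_xvars (r : 'I_(size Z)) :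
  [seq p.@[@pt K n Z r] | p <- xvars K n] = nth [::] Z r.
Proof.
have sz : size (nth [::] Z r) = n by apply/sizeZ/mem_nth.
rewrite /xvars /vars -map_comp; apply: (@eq_from_nth _ 0).
  by rewrite size_map size_enum_ord sz.
move=> i; rewrite size_map size_enum_ord => lt_in.
rewrite (nth_map (Ordinal lt_in)) ?size_enum_ord //= mevalXU /pt.
by rewrite nth_enum_ord.
Qed.

(** A vanishing [hesum] has the generator, up to sign, as its top-degree term in z; q is read off
    from the remaining terms. *)
Lemma gensJ_reduce e (g : {mpoly K[n]}) : gensJ (xvars K n) k e g ->
  exists2 q, (msize q <= e)%N & evrow Z g = evrow Z (q : {mpoly K[n]}).
Proof.
rewrite /gensJ size_xvars => -[[-> [i /andP[i_gt0 le_in] ->]]|[lt_n ->]].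
  (* These k + i - 1 values include the first i coordinates of each point, leaving only k - 1
     others, so $e_k$ of those is 0. *)
  pose a := [seq L l | l <- iota 0 (k + i).-1].
  exists (\sum_(l < k) (- (-1) ^+ k * ((-1) ^+ l * esymf a (k - l))) *:
            hsymf (take i (xvars K n)) l).
    apply: msize_lincomb => l; exists l; first exact: ltn_ord.
    by apply: dhomog_homg; apply: homg_subset (homg_hsymf _ _) => y /mem_take.
  apply/rowP => r; rewrite !mxE raddf_sum /=.
  under eq_bigr do rewrite mevalZ rmorph_hsymf map_take meval_xvars.
  rewrite rmorph_hsymf map_take meval_xvars; set z := nth _ _ _.
  have [sz uz Hz _] : [/\ size z = n, uniq z,
      forall i, (i < n)%N -> exists2 l, (l < k + i)%N & nth 0 z i = L l &
      forall l, (l < k)%N -> L l \in z] by apply: (pts_spec injL); apply: mem_nth.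
  have /eqP : hesum (take i z) a k = 0.
    apply: hesum_sub; rewrite ?take_uniq ?map_inj_uniq ?iota_uniq //; last first.
      by rewrite size_map size_iota size_takel ?sz //; lia.
    move=> x /(nthP 0)[j]; rewrite size_takel ?sz // => lt_ji.
    rewrite nth_take // => <-; have [|l lt_l ->] := Hz j; first exact: leq_trans lt_ji le_in.
    by apply: map_f; rewrite mem_iota; lia.
  rewrite /hesum big_ord_recr /= subnn esymf0 mulr1 addrC addr_eq0 => /eqP eq_h.
  rewrite -[LHS]mul1r -[X in X * _ = _](sqrr_sign K k) expr2 -mulrA eq_h mulrN -mulNr mulr_sumr.
  by apply: eq_bigr => l _; rewrite -!mulrA [esymf _ _ * _]mulrC.
(* Every point uses these k values; the other n - k coordinates have $e_e = 0$ because e > n - k. *)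
pose u := [seq L l | l <- iota 0 k].
exists (\sum_(l < e) (- ((-1) ^+ l.+1 * hsymf u l.+1)) *: esymf (xvars K n) (e - l.+1)).
  apply: msize_lincomb => l; exists (e - l.+1)%N; first by have := ltn_ord l; lia.
  by apply: dhomog_homg; apply: homg_esymf.
apply/rowP => r; rewrite !mxE raddf_sum /=.
under eq_bigr do rewrite mevalZ rmorph_esymf meval_xvars.
rewrite rmorph_esymf meval_xvars; set z := nth _ _ _.
have [sz uz _ Hz] : [/\ size z = n, uniq z,
    forall i, (i < n)%N -> exists2 l, (l < k + i)%N & nth 0 z i = L l &
    forall l, (l < k)%N -> L l \in z] by apply: (pts_spec injL); apply: mem_nth.
have /eqP : hesum u z e = 0.
  apply: hesum_sub; rewrite ?map_inj_uniq ?iota_uniq //; last first.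
    by rewrite size_map size_iota sz addnC.
  by move=> x /mapP[l]; rewrite mem_iota => /= lt_l ->; apply: Hz.
rewrite /hesum big_ord_recl hsymf0 expr0 !mul1r subn0 addr_eq0 => /eqP->.
by rewrite -sumrN; apply: eq_bigr => l _; rewrite mulNr.
Qed.

Lemma zcount_le_sum_hilbS (F : fieldType) (f : {rmorphism F -> K}) D :
  (zcount n k <= D)%N -> (zcount n k <= \sum_(d < D) hilbS F n k d)%N.
Proof.
rewrite -(size_pts n k L) => le_ZD; have := rank_Vlow_le f D gensJ_reduce.
by rewrite (Vlow_full (uniq_pts _ _ injL) sizeZ le_ZD).
Qed.

End LowerBound.

(** * Comparison of the two bounds over F(X) *)

Definition fracX (F : fieldType) (i : nat) : {fraction {poly F}} := tofrac 'X^i.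

(** Powers of X in F(X) serve as the distinct scalars $L_i$, since F itself may be finite. *)
Lemma fracX_inj F : injective (@fracX F).
Proof.
move=> i j /eqP; rewrite tofrac_eq => /eqP/(congr1 (fun p : {poly F} => size p)).
by rewrite !size_polyXn => -[].
Qed.

Theorem hilbS_eq_hdim (F : fieldType) (n k d : nat) : (k <= n)%N ->
  hilbS F n k d = hdim n k d.
Proof.
(* D is large enough for interpolation at all points and for d to be among the summands. The
   termwise bounds then force equality at d. *)
move=> le_kn; pose D := maxn (zcount n k) d.+1.
have lt_dD : (d < D)%N by rewrite leq_max leqnn orbT.
have := @zcount_le_sum_hilbS _ n k _ (@fracX_inj F) F
  (@tofrac {poly F} \o @polyC F) D (leq_maxl _ _).
move/(leq_trans (sum_hdim_le n k D)).
rewrite (bigD1 (Ordinal lt_dD)) // [X in (_ <= X)%N](bigD1 (Ordinal lt_dD)) //=.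
have : (\sum_(i < D | i != Ordinal lt_dD) hilbS F n k i <=
        \sum_(i < D | i != Ordinal lt_dD) hdim n k i)%N.
  by apply: leq_sum => i _; apply: hilbS_le_hdim.
move=> le_sum le_D; apply/eqP; rewrite eqn_leq hilbS_le_hdim //=.
rewrite -(leq_add2r (\sum_(i < D | i != Ordinal lt_dD) hdim n k i)).
by apply: leq_trans le_D _; rewrite leq_add2l.
Qed.

(* Hilb(S_{n,k}; q) = rev_q([k]!_q Stir_q(n,k)), compared coefficientwise *)
Theorem mainTheorem7 (F : fieldType) (n k : nat) :
  (0 < k)%N -> (k <= n)%N ->
  forall d : nat, (hilbS F n k d)%:Z = (revq (qfact k * stirq n k))`_d.
Proof.
move=> k_gt0 le_kn d.
by rewrite hilbS_eq_hdim // revq_qfact_stirq ?k_gt0.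
Qed.
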